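(* Assume that $\mathcal D_B\neq\emptyset$. Let $\mu>0$, let $u\in K$ be the solution of the Signorini problem, and let $u_\mu$ be the unique minimizer over $V$ of $J_\mu(v)=E(v)+\mu\mathcal B(v)$. Then $$\|u-u_\mu\|_{H^1(\Omega)}^2\le c_P^{-1}\,|\Gamma_C|\,\mu.$$
   Context: $\Omega\subset\mathbb R^d$, $d\in\{2,3\}$, is a bounded polygonal or polyhedral Lipschitz domain whose boundary is decomposed into relatively open, disjoint parts $\Gamma_D,\Gamma_C$ with $|\Gamma_D|>0$ and $\overline\Gamma_D\cup\overline\Gamma_C=\partial\Omega$. $(\cdot,\cdot)_D$ denotes the $L^2(D)$ inner product. Set $V=\{v\in H^1(\Omega): v=0\text{ on }\Gamma_D\}$, $a(v,w)=(\nabla v,\nabla w)_\Omega$, $l(w)=(f,w)_\Omega$ with $f\in L^2(\Omega)$. The constant $c_P>0$ is that of the Poincaré inequality $c_P\|w\|_{H^1(\Omega)}^2\le a(w,w)$ for all $w\in V$. The obstacle is $g\in H^{1/2}(\Gamma_C)$, and the closed convex set $K=\{v\in V: v\le g\text{ a.e. on }\Gamma_C\}$ is assumed nonempty. The Signorini problem is to minimize $E(v)=\tfrac12a(v,v)-l(v)$ over $v\in K$; equivalently, $u\in K$ is the unique solution of $a(u,v-u)-l(v-u)\ge0$ for all $v\in K$. Define $\Phi(t)=-\ln t$ for $t>0$ and $\Phi(t)=+\infty$ for $t\le0$; $\mathcal B(v)=\int_{\Gamma_C}\Phi(g-v)\,ds\in(-\infty,+\infty]$ for $v\in V$; $\mathcal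 D_B=\{v\in V:\mathcal B(v)<+\infty\}$. When $\mathcal D_B\ne\emptyset$, $J_\mu$ has a unique minimizer over $V$ for every $\mu>0$. *)

(* Defs.v *)
From HB Require Import structures.
From mathcomp Require Import all_boot all_order all_algebra.
From mathcomp Require Import all_classical all_reals all_analysis.
Set Implicit Arguments.
Unset Strict Implicit.
Unset Printing Implicit Defensive.
Import Order.TTheory GRing.Theory Num.Theory.
Import numFieldNormedType.Exports.

Local Open Scope classical_set_scope.
Local Open Scope ring_scope.

(* The norm that the library puts on ['rV[R]_d] is the sup norm; it induces the
   same topology, bounded sets and Lipschitz functions, but metric quantities
   below need the Euclidean one. *)

Definition dotv (R : realType) (d : nat) (x y : 'rV[R]_d) : R :=
  \sum_(i < d) x 0 i * y 0 i.

Definition enorm (R : realType) (d : nat) (x : 'rV[R]_d) : R :=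
  Num.sqrt (dotv x x).

(* [gauge_outer zeta A], defined below, is the infimum of [\sum_k zeta (F k)]
   over all sequences [F] of sets covering [A], the empty set being given weight
   [0].  It is [mu_ext] taken on a copy of [T] on which every set is declared
   measurable, so that all covers are allowed. *)

Definition all_sets (T : Type) : Type := T.

Section all_sets_measurable.
Context (T : pointedType).

HB.instance Definition _ := Pointed.on (all_sets T).

Let all0 : [set: set (all_sets T)] set0. Proof. by []. Qed.
Let allC (A : set (all_sets T)) : setT A -> [set: set (all_sets T)] (~` A).
Proof. by []. Qed.
Let allU (F : (set (all_sets T))^nat) : (forall i, setT (F i)) ->
  [set: set (all_sets T)] (\bigcup_i F i).
Proof. by []. Qed.

HB.instance Definition _ :=
  @isMeasurable.Build default_measure_display (all_sets T) setT all0 allC allU.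

End all_sets_measurable.

Definition gauge0 (R : realType) (T : pointedType) (zeta : set T -> \bar R)
  (U : set T) : \bar R := if `[< U = set0 >] then 0%E else zeta U.

Definition gauge_outer (R : realType) (T : pointedType)
  (zeta : set T -> \bar R) (A : set T) : \bar R :=
  @mu_ext _ (all_sets T) R (gauge0 zeta) A.

Section gauge_outer_theory.
Local Open Scope ereal_scope.
Context (R : realType) (T : pointedType) (zeta : set T -> \bar R).
Hypothesis zeta_ge0 : forall U, 0 <= zeta U.

Lemma gauge0_ge0 U : 0 <= gauge0 zeta U.
Proof. by rewrite /gauge0; case: ifP. Qed.

Lemma gauge0_set0 : gauge0 zeta set0 = 0.
Proof. by rewrite /gauge0; case: asboolP. Qed.

Lemma gauge_outer0 : gauge_outer zeta set0 = 0.
Proof.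
exact: (@mu_ext0 _ (all_sets T) R (gauge0 zeta) gauge0_set0 gauge0_ge0).
Qed.

Lemma gauge_outer_ge0 A : 0 <= gauge_outer zeta A.
Proof. exact: (@mu_ext_ge0 _ (all_sets T) R (gauge0 zeta) gauge0_ge0). Qed.

Lemma le_gauge_outer : {homo gauge_outer zeta : A B / A `<=` B >-> A <= B}.
Proof. exact: (@le_mu_ext _ (all_sets T) R (gauge0 zeta)). Qed.

Lemma gauge_outer_sigma_subadditive : sigma_subadditive (gauge_outer zeta).
Proof.
exact: (@mu_ext_sigma_subadditive _ (all_sets T) R (gauge0 zeta) gauge0_ge0).
Qed.

End gauge_outer_theory.

Section lebesgue.
Context (R : realType) (d : nat).

Definition box (a b : 'rV[R]_d) : set 'rV[R]_d :=
  [set x | forall i, a 0 i < x 0 i <= b 0 i].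

(* [+oo] on a set which is not a box, as the infimum of an empty set. *)
Definition box_volume (U : set 'rV[R]_d) : \bar R :=
  ereal_inf [set v | exists a b : 'rV[R]_d,
    [/\ forall i, a 0 i <= b 0 i, U = box a b &
        v = (\prod_(i < d) (b 0 i - a 0 i))%:E]].

Definition lebesgue_outer : set 'rV[R]_d -> \bar R := gauge_outer box_volume.

Lemma box_volume_ge0 U : (0 <= box_volume U)%E.
Proof.
apply: le_ereal_inf_tmp => _ [a [b [ab _ ->]]].
by rewrite lee_fin prodr_ge0// => i _; rewrite subr_ge0.
Qed.

HB.instance Definition _ := isOuterMeasure.Build R 'rV[R]_d lebesgue_outer
  (gauge_outer0 box_volume_ge0) (gauge_outer_ge0 box_volume_ge0)
  (@le_gauge_outer _ _ box_volume)
  (gauge_outer_sigma_subadditive box_volume_ge0).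

(* Lebesgue measure of R^d, on the sets that are measurable in the sense of
   Caratheodory. *)
Definition lebesgue_om : {outer_measure set 'rV[R]_d -> \bar R} :=
  lebesgue_outer.

Definition leb : {measure set (caratheodory_type lebesgue_om) -> \bar R} :=
  lebesgue_om : set (caratheodory_type lebesgue_om) -> \bar R.

End lebesgue.

(* Volume of the unit ball of R^s, from
   [omega_s = 2 pi / s * omega_(s-2)]. *)
Fixpoint unit_ball_volume (R : realType) (s : nat) {struct s} : R :=
  match s with
  | 0 => 1
  | 1 => 2
  | (s'.+1 as s1).+1 => 2 * pi / s1.+1%:R * unit_ball_volume R s'
  end.

Lemma unit_ball_volume_ge0 (R : realType) s : 0 <= unit_ball_volume R s.
Proof.
suff: 0 <= unit_ball_volume R s /\ 0 <= unit_ball_volume R s.+1 by case.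
elim: s => [|s [IH1 IH2]]; first by split => /=.
split => //; rewrite [unit_ball_volume R s.+2]/=.
by rewrite mulr_ge0// divr_ge0// mulr_ge0// pi_ge0.
Qed.

Section hausdorff.
Context (R : realType) (d : nat).

(* [-oo] on the empty set, which [gauge0] treats separately. *)
Definition diam (U : set 'rV[R]_d) : \bar R :=
  ereal_sup [set (enorm (p.1 - p.2))%:E | p in U `*` U].

(* The factor [omega_s / 2 ^ s] makes the s-dimensional Hausdorff measure
   coincide with length for [s = 1] and surface area for [s = 2]. *)
Definition hausdorff_gauge (s : nat) (delta : R) (U : set 'rV[R]_d) : \bar R :=
  if (diam U <= delta%:E)%E
  then (unit_ball_volume R s * (fine (diam U) / 2) ^+ s)%:E else +oo%E.

Definition hausdorff_outer (s : nat) (A : set 'rV[R]_d) : \bar R :=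
  ereal_sup [set gauge_outer (hausdorff_gauge s delta) A |
             delta in [set delta | 0 < delta]].

Lemma fine_diam_ge0 (U : set 'rV[R]_d) : 0 <= fine (diam U).
Proof.
have [->|/set0P[x Ux]] := eqVneq U set0.
  by rewrite /diam setX0 image_set0 ereal_sup0.
apply: fine_ge0; apply: le_ereal_sup_tmp; exists (enorm (x - x))%:E.
  by exists (x, x).
by rewrite lee_fin sqrtr_ge0.
Qed.

Lemma hausdorff_gauge_ge0 s delta U : (0 <= hausdorff_gauge s delta U)%E.
Proof.
rewrite /hausdorff_gauge; case: ifP => // _.
by rewrite lee_fin mulr_ge0 ?unit_ball_volume_ge0// exprn_ge0// divr_ge0//
   fine_diam_ge0.
Qed.

Section hausdorff_outer_measure.
Local Open Scope ereal_scope.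
Variable s : nat.
Let ge0 delta := @hausdorff_gauge_ge0 s delta.

Lemma hausdorff_outer0 : hausdorff_outer s set0 = 0.
Proof.
rewrite /hausdorff_outer (_ : [set _ | _ in _] = [set 0]) ?ereal_sup1//.
apply/seteqP; split => [_ [delta _ <-]|_ ->] /=.
  by rewrite (gauge_outer0 (@ge0 delta)).
by exists 1%R; [exact: ltr01|rewrite (gauge_outer0 (@ge0 _))].
Qed.

Lemma hausdorff_outer_ge0 A : 0 <= hausdorff_outer s A.
Proof.
apply: le_ereal_sup_tmp; exists (gauge_outer (hausdorff_gauge s 1%R) A).
  by exists 1%R => //=; exact: ltr01.
exact: gauge_outer_ge0 (@ge0 _) _.
Qed.

Lemma le_hausdorff_outer : {homo hausdorff_outer s : A B / A `<=` B >-> A <= B}.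
Proof.
move=> A B AB; apply: ge_ereal_sup => _ [delta delta0 <-].
apply: (le_trans (le_gauge_outer _ AB)).
by apply: ereal_sup_ubound; exists delta.
Qed.

Lemma hausdorff_outer_sigma_subadditive :
  sigma_subadditive (hausdorff_outer s).
Proof.
move=> F; apply: ge_ereal_sup => _ [delta delta0 <-].
apply: (le_trans (gauge_outer_sigma_subadditive (@ge0 delta) F)).
apply: lee_nneseries => n _; first by move=> *; exact: gauge_outer_ge0 (@ge0 _) _.
by apply: ereal_sup_ubound; exists delta.
Qed.

HB.instance Definition _ := isOuterMeasure.Build R 'rV[R]_d (hausdorff_outer s)
  hausdorff_outer0 hausdorff_outer_ge0 le_hausdorff_outer
  hausdorff_outer_sigma_subadditive.

End hausdorff_outer_measure.

Definition hausdorff_om (s : nat) :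
  {outer_measure set 'rV[R]_d -> \bar R} := hausdorff_outer s.

Definition hausdorff (s : nat) :
    {measure set (caratheodory_type (hausdorff_om s)) -> \bar R} :=
  hausdorff_om s : set (caratheodory_type (hausdorff_om s)) -> \bar R.

End hausdorff.

(* Surface measure [ds] on hypersurfaces of R^d. *)
Definition surf (R : realType) (d : nat) := hausdorff R d d.-1.

Section domains.
Context (R : realType) (d : nat).
Local Notation pt := 'rV[R]_d.
Implicit Types (Omega GammaD GammaC : set pt).

Definition boundary (A : set pt) : set pt := closure A `\` interior A.

(* Convex hull of [d] points: a segment for [d = 2], a triangle for [d = 3]. *)
Definition facet (p : 'I_d -> pt) : set pt :=
  [set x | exists t : 'I_d -> R,
    [/\ forall i, 0 <= t i, \sum_(i < d) t i = 1 &
        x = \sum_(i < d) t i *: p i]].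

Definition polyhedral Omega : Prop :=
  exists (m : nat) (p : 'I_m -> 'I_d -> pt),
    boundary Omega = \bigcup_k facet (p k).

(* Near each boundary point, [Omega] is the set lying strictly above the graph
   of a Lipschitz function; [e] is the vertical direction and
   [x - dotv x e *: e] the horizontal part of [x]. *)
Definition lipschitz_boundary Omega : Prop :=
  forall x0, boundary Omega x0 ->
  exists (U : set pt) (e : pt) (phi : pt -> R),
    [/\ open U, U x0, enorm e = 1, [lipschitz phi x | x in [set: pt]] &
        forall x, U x -> (Omega x <-> phi (x - dotv x e *: e) < dotv x e)].

Definition polyhedral_lipschitz_domain Omega : Prop :=
  [/\ open Omega, connected Omega, Omega !=set0 & bounded_set Omega] /\
  polyhedral Omega /\ lipschitz_boundary Omega.

Definition relatively_open (S A : set pt) : Prop :=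
  exists2 U : set pt, open U & A = S `&` U.

Definition boundary_decomposition Omega GammaD GammaC : Prop :=
  [/\ relatively_open (boundary Omega) GammaD,
      relatively_open (boundary Omega) GammaC,
      GammaD `&` GammaC = set0 &
      closure GammaD `|` closure GammaC = boundary Omega].

End domains.

Definition L2 (R : realType) (disp : measure_display) (T : measurableType disp)
    (mu : {measure set T -> \bar R}) (D : set T) (f : T -> R) : Prop :=
  measurable_fun D f /\ mu.-integrable D (fun x => (f x ^+ 2)%:E).

Section sobolev.
Context (R : realType) (d : nat).
Local Notation pt := 'rV[R]_d.
Local Notation leb := (leb R d).
Local Notation surf := (surf R d).

Definition partial (i : 'I_d) (f : pt -> R) : pt -> R :=
  fun x => 'D_(delta_mx 0 i) f x.

Definition smooth (f : pt -> R) : Prop :=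
  forall (s : seq 'I_d) (x : pt), differentiable (foldr partial f s) x.

Definition test_function (Omega : set pt) (phi : pt -> R) : Prop :=
  smooth phi /\
  exists C : set pt, [/\ compact C, C `<=` Omega & forall x, ~ C x -> phi x = 0].

Definition weak_gradient (Omega : set pt) (v : pt -> R) (G : pt -> pt) : Prop :=
  forall (phi : pt -> R) (i : 'I_d), test_function Omega phi ->
    \int[leb]_(x in Omega) (v x * partial i phi x) =
    - \int[leb]_(x in Omega) (G x 0 i * phi x).

(* An element of [H^1(Omega)] is represented by a triple made of a function
   [fn w] on [Omega], its weak gradient [gr w] and its trace [tr w] on the
   boundary.  The last two are determined by the first up to null sets, and
   exist for every class in [H^1(Omega)] (by definition and by the trace
   theorem respectively); carrying representatives makes the vector space
   operations componentwise.  Values outside [Omega], resp. outside its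
   boundary, are irrelevant. *)
Definition h1rep : lmodType R :=
  ((pt -> R) * (pt -> pt) * (pt -> R))%type.

Definition fn (w : h1rep) : pt -> R := w.1.1.
Definition gr (w : h1rep) : pt -> pt := w.1.2.
Definition tr (w : h1rep) : pt -> R := w.2.

Definition smooth_rep (phi : pt -> R) : h1rep :=
  (phi, fun x => \row_i partial i phi x, phi).

Definition h1norm2 (Omega : set pt) (w : h1rep) : \bar R :=
  (\int[leb]_(x in Omega) (fn w x ^+ 2 + dotv (gr w x) (gr w x))%:E)%E.

Definition h1norm (Omega : set pt) (w : h1rep) : R :=
  Num.sqrt (fine (h1norm2 Omega w)).

Definition bnorm2 (Omega : set pt) (w : h1rep) : \bar R :=
  (\int[surf]_(x in boundary Omega) (tr w x ^+ 2)%:E)%E.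

(* The trace operator is the continuous extension to [H^1(Omega)] of the
   restriction to the boundary of functions smooth up to the boundary. *)
Definition is_trace (Omega : set pt) (w : h1rep) : Prop :=
  L2 surf (boundary Omega) (tr w) /\
  exists phi : nat -> pt -> R,
    [/\ forall k, smooth (phi k),
        h1norm2 Omega (smooth_rep (phi k) - w) @[k --> \oo] --> 0%E &
        bnorm2 Omega (smooth_rep (phi k) - w) @[k --> \oo] --> 0%E].

Definition H1 (Omega : set pt) : set h1rep :=
  [set w | [/\ L2 leb Omega (fn w),
               forall i, L2 leb Omega (fun x => gr w x 0 i),
               weak_gradient Omega (fn w) (gr w) &
               is_trace Omega w]].

(* [H^{1/2}(Gamma)] for a [d-1]-dimensional [Gamma], with the
   Sobolev-Slobodeckij seminorm: the exponent is [(d - 1) + 2 * (1/2) = d]. *)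
Definition H12 (Gamma : set pt) (g : pt -> R) : Prop :=
  L2 surf Gamma g /\
  (\int[surf]_(x in Gamma) \int[surf]_(y in Gamma)
     ((g x - g y) ^+ 2 / enorm (x - y : pt) ^+ d)%:E < +oo)%E.

End sobolev.

Section signorini.
Context (R : realType) (d : nat).
Local Notation pt := 'rV[R]_d.
Local Notation leb := (leb R d).
Local Notation surf := (surf R d).
Variables (Omega GammaD GammaC : set pt) (f g : pt -> R).
Implicit Types v w : h1rep R d.

Definition space_V : set (h1rep R d) :=
  [set v | H1 Omega v /\ {ae surf, forall x, GammaD x -> tr v x = 0}].

Definition set_K : set (h1rep R d) :=
  [set v | space_V v /\ {ae surf, forall x, GammaC x -> tr v x <= g x}].

Definition form_a v w : R := \int[leb]_(x in Omega) dotv (gr v x) (gr w x).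

Definition form_l w : R := \int[leb]_(x in Omega) (f x * fn w x).

Definition energy v : R := 2^-1 * form_a v v - form_l v.

Definition Phi (t : R) : \bar R := if 0 < t then (- ln t)%:E else +oo%E.

(* The positive and negative parts of the integrand are integrated separately;
   the latter is integrable as [- ln t >= 1 - t]. *)
Definition barrier v : \bar R := (\int[surf]_(x in GammaC) Phi (g x - tr v x))%E.

Definition dom_B : set (h1rep R d) := [set v | space_V v /\ (barrier v < +oo)%E].

Definition energy_mu (mu : R) v : \bar R := ((energy v)%:E + mu%:E * barrier v)%E.

Definition signorini_solution (u : h1rep R d) : Prop :=
  set_K u /\ forall v, set_K v -> energy u <= energy v.

Definition barrier_minimizer (mu : R) (u : h1rep R d) : Prop :=
  space_V u /\ forall v, space_V v -> (energy_mu mu u <= energy_mu mu v)%E.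

Definition poincare_constant (cP : R) : Prop :=
  0 < cP /\ forall w, space_V w -> cP * h1norm Omega w ^+ 2 <= form_a w w.

End signorini.

(* Main.v *)
(* Both minimality conditions are tested along the segment between u and u_mu,
   with e = u - u_mu and 0 < t < 1. As u - t e stays in K, E(u) <= E(u - t e).
   At u_mu + t e the gap to the obstacle is at least (1 - t) times the gap of
   u_mu, so the barrier grows by at most -ln(1 - t) |Gamma_C|, which is at most
   t / (1 - t) |Gamma_C|; hence
   E(u_mu) <= E(u_mu + t e) + mu t / (1 - t) |Gamma_C|. Adding the two quadratic
   expansions leaves (1 - t)^2 a(e, e) <= mu |Gamma_C|; let t tend to 0 and use
   the Poincare inequality. If |Gamma_C| is infinite there is nothing to prove.

   Linearity of the integrals involved rests on Borel sets being Caratheodory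
   measurable: it suffices to treat half-spaces {x_i <= c}, which split a box
   into two boxes, and which are handled for the Hausdorff measure by
   Caratheodory's criterion for metric outer measures. *)
Require Import Defs.
From mathcomp Require Import all_boot all_order all_algebra.
From mathcomp Require Import all_classical all_reals all_analysis.
From mathcomp Require Import measurable_realfun ring lra.
Set Implicit Arguments.
Unset Strict Implicit.
Unset Printing Implicit Defensive.
Import Order.TTheory GRing.Theory Num.Theory.
Import numFieldNormedType.Exports.
Local Open Scope classical_set_scope.
Local Open Scope ring_scope.

(** * Borel sets of the Lebesgue and Hausdorff measures *)

Section splitting.
Local Open Scope ereal_scope.

(** Any cover of the union is split set by set into a cover of [A] and a cover of [B], without
    raising the total weight; the infimum over covers then gives the bound. *)
Lemma gauge_outer_superadditive (R : realType) (T : pointedType)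
    (zeta : set T -> \bar R) (A B : set T) :
    (forall U, 0 <= zeta U) ->
    (forall U, exists U1 U2, [/\ A `&` U `<=` U1, B `&` U `<=` U2 &
      gauge0 zeta U1 + gauge0 zeta U2 <= gauge0 zeta U]) ->
  gauge_outer zeta A + gauge_outer zeta B <= gauge_outer zeta (A `|` B).
Proof.
move=> zeta0 split; apply: le_ereal_inf_tmp => _ [F [_ ABF] <-].
have [U1 /choice[U2 UP]] := choice (fun k => split (F k)).
have ge0 U : 0 <= gauge0 zeta U by exact: gauge0_ge0.
apply: (@le_trans _ _ (\sum_(k <oo) (gauge0 zeta (U1 k) + gauge0 zeta (U2 k)))).
  rewrite nneseriesD//; apply: leeD; apply: ereal_inf_lbound.
  - exists U1 => //; split => // x Ax; have [k _ Fkx] := ABF x (or_introl Ax).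
    by exists k => //; have [+ _ _] := UP k; apply.
  - exists U2 => //; split => // x Bx; have [k _ Fkx] := ABF x (or_intror Bx).
    by exists k => //; have [_ + _] := UP k; apply.
apply: lee_nneseries => k *; first by rewrite adde_ge0.
by have [_ _] := UP k.
Qed.

(** Caratheodory's argument: the part of [X] where [f > c] is exhausted by the sets [B n], each
    separated from [P], so [mu P + mu (B n) <= mu X]. It remains to see that [mu Q] is at most the
    supremum of the [mu (B n)], which follows once the slabs left over have small total measure. *)
Lemma caratheodory_sublevel (R : realType) (T : Type)
    (mu : {outer_measure set T -> \bar R}) (f : T -> R) (c : R) :
    (forall (A B : set T) r1 r2, (r1 < r2)%R ->
      (forall x, A x -> f x <= r1)%R -> (forall x, B x -> r2 <= f x)%R ->
      mu A + mu B <= mu (A `|` B)) ->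
  mu.-caratheodory [set x | (f x <= c)%R].
Proof.
move=> sep; have mu0 Y : 0 <= mu Y := outer_measure_ge0 mu Y.
apply: le_caratheodory_measurable => X.
have [->|] := eqVneq (mu X) +oo; first by rewrite leey.
rewrite -ltey -ge0_fin_numE// => finX.
set P := X `&` _; set Q := X `&` _.
have fin Y : Y `<=` X -> mu Y \is a fin_num.
  move=> YX; rewrite ge0_fin_numE//; apply: le_lt_trans (le_outer_measure mu _ _ YX) _.
  by rewrite -ge0_fin_numE.
pose e n : R := (c + n.+1%:R^-1)%R.
have eS n : (e n.+1 < e n)%R by rewrite /e ltrD2l ltf_pV2 ?posrE// ltr_nat.
pose B n := X `&` [set x | e n <= f x]%R.
pose D n := X `&` [set x | e n.+1 <= f x < e n]%R.
have BX n : B n `<=` X by move=> x [].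
have DX n : D n `<=` X by move=> x [].
pose a n := fine (mu (B n)).
have aE n : mu (B n) = (a n)%:E by rewrite fineK// fin.
pose b n := fine (mu (D n)).
have bE n : mu (D n) = (b n)%:E by rewrite fineK// fin.
have PX : P `<=` X by move=> x [].
have QX : Q `<=` X by move=> x [].
(* [B n] and [D n.+1] are separated by the slab [D n], so the measures of the
   slabs telescope. *)
have ab n : (b n.+1 + a n <= a n.+2)%R.
  rewrite -lee_fin EFinD -aE -bE -aE.
  apply: (@le_trans _ _ (mu (D n.+1 `|` B n))).
    apply: (sep _ _ (e n.+1) (e n) (eS n)); last by move=> x [].
    by move=> x [_ /andP[_ /ltW]].
  apply: le_outer_measure => x [[Xx /andP[h _]]|[Xx h]]; split => //=.
  by apply: le_trans h; apply/ltW/(lt_trans (eS n.+1) (eS n)).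
(* As [ab] relates indices two apart, two consecutive values of [a] are carried along, which sums
   the slabs of both parities at once. *)
have tele n k : (\sum_(j < k) b (n + j).+1 + (a n + a n.+1) <=
    a (n + k)%N + a (n + k).+1)%R.
  elim: k => [|k IH]; first by rewrite big_ord0 add0r addn0.
  rewrite big_ord_recr/= addnS; have := ab (n + k)%N; lra.
have aP n : (fine (mu P) + a n <= fine (mu X))%R.
  rewrite -lee_fin EFinD -aE !fineK// ?fin//.
  apply: le_trans (le_outer_measure mu _ _ (_ : P `|` B n `<=` X)); last first.
    by move=> x [/PX|/BX].
  apply: (sep _ _ c (e n)); first by rewrite /e ltrDl invr_gt0.
    by move=> x [].
  by move=> x [].
have supS : has_sup (range a).
  split; first by exists (a 0%N), 0%N.
  exists (fine (mu X)) => _ [n _ <-]; apply: le_trans (aP n).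
  by rewrite lerDr fine_ge0.
have aL n : (a n <= sup (range a))%R by apply: ub_le_sup; [case: supS|exists n].
have PL : (fine (mu P) + sup (range a) <= fine (mu X))%R.
  rewrite -lerBrDl; apply: ge_sup; first by case: supS.
  by move=> _ [n _ <-]; rewrite lerBrDl.
suff QL : (fine (mu Q) <= sup (range a))%R.
  rewrite -(fineK (fin _ PX)) -(fineK (fin _ QX)) -(fineK finX) -EFinD lee_fin.
  by apply: le_trans PL; rewrite lerD2l.
apply/ler_addgt0Pr => eps eps0.
(* By [tele] the slabs after [n] have total measure at most [2 * sup (range a) - a n - a n.+1],
   which is below [eps] for this [n]. *)
have [_ [n _ <-] an] : exists2 z, range a z & (sup (range a) - eps / 2 < z)%R.
  by apply: sup_adherent => //; rewrite divr_gt0.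
rewrite -lee_fin fineK ?fin//.
have QU : Q `<=` B n.+1 `|` \bigcup_j D (n + j).+1.
  move=> x [Xx /negP]; rewrite -ltNge => cx.
  have [h|h] := leP (e n.+1) (f x); first by left.
  right; have [m m0] : exists m, (e m <= f x)%R.
    have /archi_boundP h0 : (0 <= (f x - c)^-1)%R by rewrite invr_ge0 subr_ge0 ltW.
    exists (Num.bound (f x - c)^-1)%R; rewrite /e -lerBrDl.
    rewrite invf_ple ?posrE ?subr_gt0//.
    by apply/ltW/(lt_le_trans h0); rewrite ler_nat.
  (* The least such index is a successor [k.+1], and minimality puts [x] in the slab [D k]. *)
  have em : exists m, (e m <= f x)%R by exists m.
  case: (ex_minnP em) => -[|k] ek kmin.
    move: h; rewrite ltNge => /negP[]; apply: le_trans ek.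
    by rewrite /e lerD2l lef_pV2 ?posrE// ler_nat.
  have kn : (n.+1 <= k)%N.
    rewrite leqNgt; apply/negP => kn; move: h; rewrite ltNge => /negP[].
    by apply: le_trans ek; rewrite /e lerD2l lef_pV2 ?posrE// ler_nat ltnS.
  exists (k - n.+1)%N => //; rewrite -addSn subnKC//; split => //=.
  rewrite ek/= ltNge; apply/negP => /kmin; by rewrite ltnn.
apply: (le_trans (le_outer_measure mu _ _ QU)).
apply: (le_trans (outer_measureU2 _ _ _)).
apply: (@le_trans _ _ ((sup (range a))%:E + eps%:E)); last by rewrite EFinD.
apply: leeD; first by rewrite aE lee_fin.
apply: (le_trans (outer_measure_sigma_subadditive mu _)).
apply: lime_le; first by apply: is_cvg_nneseries.
apply: nearW => k; rewrite big_mkord.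
under eq_bigr do rewrite bE.
rewrite sumEFin lee_fin; have := tele n k.
have := aL (n + k)%N; have := aL (n + k).+1; have := ab n; have := aL n.+1.
have : (a n <= a n.+1)%R.
  rewrite -lee_fin -!aE; apply: le_outer_measure => x [Xx /= h]; split => //=.
  exact: le_trans (ltW (eS n)) h.
set S := (\sum_(_ < _) _)%R; move: an; lra.
Qed.

End splitting.

(** * Half-spaces are Caratheodory measurable *)

Section halfspaces.
Context (R : realType) (d : nat).
Local Notation pt := 'rV[R]_d.
Local Open Scope ereal_scope.

(** A closed half-space and its complement cut a box, open below and closed above in each
    coordinate, into two boxes of exactly this kind, and the volumes add up. *)
Lemma lebesgue_halfspace (i : 'I_d) (c : R) :
  (@lebesgue_om R d).-caratheodory [set x : pt | (x 0 i <= c)%R].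
Proof.
apply: le_caratheodory_measurable => X; set H := [set x | _].
rewrite -[in leRHS](setIT X) -(setUCr H) setIUr.
apply: gauge_outer_superadditive => [U|U]; first exact: box_volume_ge0.
exists (U `&` H), (U `&` ~` H); split.
- by move=> x [[_ ?] ?].
- by move=> x [[_ ?] ?].
have g_le V : gauge0 (@box_volume R d) V <= box_volume V.
  by rewrite /gauge0; case: ifP => // _; exact: box_volume_ge0.
have [->|/set0P[z Uz]] := eqVneq U set0.
  by rewrite !set0I gauge0_set0 adde0.
rewrite [leRHS]/gauge0 asboolF; last by move=> U0; rewrite U0 in Uz.
apply: le_ereal_inf_tmp => _ [a [b [ab UE ->]]].
(* The cutting level [c] is clamped to the side of the box; if the hyperplane misses the box, one of
   the two pieces is degenerate. *)
pose m : R := Num.max (a 0%R i) (Num.min c (b 0%R i)).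
pose b' : pt := (\row_j if j == i then m else b 0 j)%R.
pose a' : pt := (\row_j if j == i then m else a 0 j)%R.
have am : (a 0 i <= m)%R by rewrite le_max lexx.
have mb : (m <= b 0 i)%R by rewrite ge_max ab ge_min lexx orbT.
have U1 : U `&` H = box a b'.
  rewrite UE; apply/seteqP; split => x.
    move=> [abx /= xc] j; rewrite mxE; case: eqVneq => [->|_]; last exact: abx.
    have /andP[-> xb] := abx i.
    by rewrite le_max le_min xc xb orbT.
  move=> abx; split => [j|].
    have := abx j; rewrite mxE; case: eqVneq => [->|//].
    by move=> /andP[-> /le_trans]; apply.
  have := abx i; rewrite mxE eqxx => /andP[ax].
  by rewrite le_max leNgt ax/= le_min => /andP[].
have U2 : U `&` ~` H = box a' b.
  rewrite UE; apply/seteqP; split => x.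
    move=> [abx /= /negP xc] j; rewrite mxE; case: eqVneq => [->|_]; last exact: abx.
    have /andP[ax ->] := abx i.
    by rewrite gt_max ax gt_min ltNge xc.
  move=> abx; split => [j|].
    have := abx j; rewrite mxE; case: eqVneq => [->|//].
    by move=> /andP[h ->]; rewrite (le_lt_trans am h).
  have := abx i; rewrite mxE eqxx => /andP[+ xb].
  rewrite gt_max gt_min => /andP[_ /orP[cx|]]; first by apply/negP; rewrite -ltNge.
  by rewrite ltNge xb.
pose P := (\prod_(j < d | j != i) (b 0 j - a 0 j))%R.
apply: (@le_trans _ _ (((m - a 0 i) * P)%:E + ((b 0 i - m) * P)%:E)); last first.
  by rewrite -EFinD lee_fin (bigD1 i)//= -/P -mulrDl; lra.
apply: leeD; apply: (le_trans (g_le _)); apply: ereal_inf_lbound.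
  exists a, b'; split => //.
    by move=> j; rewrite mxE; case: eqVneq => [->|].
  rewrite (bigD1 i)//= mxE eqxx; congr (_ * _)%:E; apply: eq_bigr => j /negbTE ji.
  by rewrite mxE ji.
exists a', b; split => //.
  by move=> j; rewrite mxE; case: eqVneq => [->|].
rewrite (bigD1 i)//= mxE eqxx; congr (_ * _)%:E; apply: eq_bigr => j /negbTE ji.
by rewrite mxE ji.
Qed.

Lemma coord_le_enorm (x : pt) (i : 'I_d) : (`|x 0 i| <= enorm x)%R.
Proof.
rewrite -sqrtr_sqr ler_sqrt ?sumr_ge0// => [|j _]; last by rewrite -expr2 sqr_ge0.
rewrite /dotv (bigD1 i)//= -expr2 lerDl sumr_ge0// => j _.
by rewrite -expr2 sqr_ge0.
Qed.

(** A coordinate is 1-Lipschitz for the Euclidean norm, so a set of diameter less than [r2 - r1]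
    cannot meet both [A] and [B]: each set of a fine cover is assigned to one of the two. *)
Lemma hausdorff_halfspace (s : nat) (i : 'I_d) (c : R) :
  (@hausdorff_om R d s).-caratheodory [set x : pt | (x 0 i <= c)%R].
Proof.
apply: caratheodory_sublevel => A B r1 r2 r12 Ar Br.
have Hge0 delta V : 0 <= gauge_outer (hausdorff_gauge s delta) V :> \bar R.
  by apply: gauge_outer_ge0 => U; exact: hausdorff_gauge_ge0.
(* A smaller scale gives weight [+oo] to more sets, hence a larger infimum. *)
have anti (d1 d2 : R) V : (d1 <= d2)%R ->
    gauge_outer (hausdorff_gauge s d2) V <= gauge_outer (hausdorff_gauge s d1) V.
  move=> d12; apply: le_ereal_inf_tmp => _ [F FV <-].
  apply: (@le_trans _ _ (\sum_(k <oo) gauge0 (hausdorff_gauge s d2) (F k))).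
    by apply: ereal_inf_lbound; exists F.
  apply: lee_nneseries => k *.
    by apply: gauge0_ge0 => U; exact: hausdorff_gauge_ge0.
  rewrite /gauge0; case: ifP => // _; rewrite /hausdorff_gauge.
  case: (leP _ d1%:E) => h1; last by rewrite leey.
  by rewrite (le_trans h1)// lee_fin.
have key (delta : R) : (delta < r2 - r1)%R ->
    gauge_outer (hausdorff_gauge s delta) A + gauge_outer (hausdorff_gauge s delta) B
    <= gauge_outer (hausdorff_gauge s delta) (A `|` B).
  move=> dlt; apply: gauge_outer_superadditive => [U|U].
    exact: hausdorff_gauge_ge0.
  have [Uoo|] := eqVneq (gauge0 (hausdorff_gauge s delta) U) +oo.
    by exists U, U; split; [move=> x []|move=> x []|rewrite Uoo leey].
  rewrite /gauge0; case: asboolP => [-> _|U0].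
    by exists set0, set0; split; rewrite ?setI0//; case: asboolP; rewrite ?adde0.
  rewrite {1}/hausdorff_gauge; case: ifPn => // diamU _.
  have dist x y : U x -> U y -> (x 0 i - y 0 i <= delta)%R.
    move=> Ux Uy; rewrite -lee_fin; apply: le_trans diamU.
    apply: (@le_trans _ _ (enorm (x - y))%:E).
      rewrite lee_fin; apply: le_trans (coord_le_enorm _ i).
      by rewrite !mxE ler_norm.
    by apply: ereal_sup_ubound; exists (x, y).
  have [[x [Ax Ux]]|noA] := pselect (A `&` U !=set0).
    exists U, set0; split.
    - by move=> y [].
    - move=> y [By Uy]; have := dist _ _ Uy Ux; have := Ar _ Ax; have := Br _ By.
      by move: dlt => + ? ? ?; lra.
    - by case: asboolP => // _; case: asboolP => // _; rewrite adde0.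
  exists set0, U; split.
  - by move=> y AUy; apply: noA; exists y.
  - by move=> y [].
  - by rewrite asboolT// asboolF// add0e.
apply/lee_addgt0Pr => eps eps0.
have [Zoo|] := eqVneq (hausdorff_outer s (A `|` B)) +oo.
  by rewrite /= Zoo addye// leey.
rewrite -ltey -ge0_fin_numE; last exact: hausdorff_outer_ge0.
move=> finZ.
(* Both scales are compared with a common finer one, so that they may vary independently and the two
   suprema can be taken one after the other. *)
have pair (d1 d2 : R) : (0 < d1)%R -> (0 < d2)%R ->
    gauge_outer (hausdorff_gauge s d1) A + gauge_outer (hausdorff_gauge s d2) B
    <= hausdorff_outer s (A `|` B).
  move=> d10 d20; pose delta := Num.min (Num.min d1 d2) ((r2 - r1) / 2)%R.
  have delta0 : (0 < delta)%R by rewrite !lt_min d10 d20/=; lra.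
  have delta1 : (delta <= d1)%R by rewrite !ge_min lexx.
  have delta2 : (delta <= d2)%R by rewrite !ge_min lexx orbT.
  have delta3 : (delta < r2 - r1)%R.
    apply: (@le_lt_trans _ _ ((r2 - r1) / 2)%R); last by lra.
    by rewrite ge_min lexx orbT.
  apply: (@le_trans _ _ (gauge_outer (hausdorff_gauge s delta) A +
      gauge_outer (hausdorff_gauge s delta) B)).
    by apply: leeD; exact: anti.
  apply: (le_trans (key _ delta3)).
  by apply: ereal_sup_ubound; exists delta.
have finB (d2 : R) : (0 < d2)%R -> gauge_outer (hausdorff_gauge s d2) B \is a fin_num.
  move=> d20; rewrite ge0_fin_numE//.
  apply: (@le_lt_trans _ _ (hausdorff_outer s (A `|` B))).
    by apply: le_trans (pair _ _ ltr01 d20); rewrite leeDr.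
  by rewrite -ge0_fin_numE//; exact: hausdorff_outer_ge0.
have A_le (d2 : R) : (0 < d2)%R -> hausdorff_outer s A <=
    hausdorff_outer s (A `|` B) - gauge_outer (hausdorff_gauge s d2) B.
  move=> d20; apply: ge_ereal_sup => _ [d1 d10 <-].
  by rewrite leeBrDr ?finB// pair.
have finA : hausdorff_outer s A \is a fin_num.
  rewrite ge0_fin_numE; last exact: hausdorff_outer_ge0.
  apply: le_lt_trans (A_le 1%R ltr01) _.
  by rewrite -ge0_fin_numE ?fin_numB ?finZ ?finB// (le_trans _ (A_le 1%R ltr01))//
    hausdorff_outer_ge0.
apply: (@le_trans _ _ (hausdorff_outer s (A `|` B))); last by rewrite leeDl// lee_fin ltW.
rewrite -leeBrDl//; apply: ge_ereal_sup => _ [d2 d20 <-].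
by rewrite leeBrDl// -leeBrDr ?finB// A_le.
Qed.

End halfspaces.

(** * Open and closed sets and continuous functions are measurable *)

Section borel.
Context (R : realType) (d : nat) (om : {outer_measure set 'rV[R]_d -> \bar R}).
Local Notation pt := 'rV[R]_d.
Local Notation T := (caratheodory_type om).
Hypothesis om_halfspace :
  forall (i : 'I_d) (c : R), om.-caratheodory [set x : pt | x 0 i <= c].

Lemma measurable_box (a b : pt) : measurable (box a b : set T).
Proof.
rewrite (_ : box a b = \bigcap_(i in [set: 'I_d])
    ([set x : pt | x 0 i <= b 0 i] `\` [set x : pt | x 0 i <= a 0 i])).
  apply: fin_bigcap_measurable => // i _.
  by apply: measurableD; exact: om_halfspace.
apply/seteqP; split => x /=.
  by move=> abx i _; have /andP[? ?] := abx i; split => //; apply/negP; rewrite -ltNge.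
by move=> abx i; have [-> /negP] := abx i I; rewrite -ltNge => ->.
Qed.

(** Balls are defined coordinatewise, so a box with rational corners fits between a point and any
    ball around it. Rational corners make the union countable. *)
Lemma open_box_bigcup (U : set pt) : open U ->
  U = \bigcup_(p in [set p : 'rV[rat]_d * 'rV[rat]_d |
        box (map_mx ratr p.1) (map_mx ratr p.2) `<=` U])
      box (map_mx ratr p.1) (map_mx ratr p.2).
Proof.
move=> oU; apply/seteqP; split => [x Ux|x [p pU]]; last exact: pU.
have /nbhs_ballP[e /= e0 eU] : nbhs x U by exact: open_nbhs_nbhs.
have lo i : x 0 i - e < x 0 i by rewrite ltrBlDr ltrDl.
have hi i : x 0 i < x 0 i + e by rewrite ltrDl.
have [a ax] := choice (fun i => rat_in_itvoo (lo i)).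
have [b bx] := choice (fun i => rat_in_itvoo (hi i)).
exists (\row_i a i, \row_i b i) => /= [y aby|i].
  apply: eU; split => // i j; rewrite ord1 /ball/=.
  move: (aby j) (ax j) (bx j); rewrite !mxE !in_itv/= ltr_norml.
  by move=> /andP[? ?] /andP[? ?] /andP[? ?]; lra.
move: (ax i) (bx i); rewrite !mxE !in_itv/=.
by move=> /andP[_ ->] /andP[/ltW -> _].
Qed.

Lemma measurable_open (U : set pt) : open U -> measurable (U : set T).
Proof.
move=> /open_box_bigcup ->; rewrite bigcup_mkcond.
apply: countable_bigcupT_measurable => // p.
by case: ifP => // _; exact: measurable_box.
Qed.

Lemma measurable_closed (U : set pt) : closed U -> measurable (U : set T).
Proof.
move=> cU; rewrite -(setCK U); apply: measurableC; apply: measurable_open.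
exact: closed_openC.
Qed.

Lemma continuous_measurable (f : pt -> R) (D : set pt) :
  continuous f -> measurable_fun (D : set T) (f : T -> R).
Proof.
move=> cf; apply: measurable_funTS => mT.
apply: (measurability _ (RGenOInfty.measurableE R)) => //.
move=> _ [_ [a ->] <-]; rewrite setTI; apply: measurable_open.
by apply: (open_comp (fun x _ => cf x)); exact: interval_open.
Qed.

End borel.

(** * Measurability and finiteness for volume and surface measure *)

Section leb_surf.
Context (R : realType) (d : nat).
Local Notation pt := 'rV[R]_d.

Lemma leb_measurable_open (U : set pt) : open U ->
  measurable (U : set (caratheodory_type (lebesgue_om R d))).
Proof. by apply: measurable_open; exact: lebesgue_halfspace. Qed.

Lemma leb_measurable_continuous (f : pt -> R) (D : set pt) : continuous f ->
  measurable_fun (D : set (caratheodory_type (lebesgue_om R d))) f.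
Proof. by apply: continuous_measurable; exact: lebesgue_halfspace. Qed.

Lemma surf_measurable_continuous (f : pt -> R) (D : set pt) : continuous f ->
  measurable_fun (D : set (caratheodory_type (hausdorff_om R d d.-1))) f.
Proof. by apply: continuous_measurable; exact: hausdorff_halfspace. Qed.

Lemma surf_measurable_boundary (Omega : set pt) :
  measurable (boundary Omega : set (caratheodory_type (hausdorff_om R d d.-1))).
Proof.
apply: measurable_closed; first exact: hausdorff_halfspace.
rewrite /boundary setDE; apply: closedI; first exact: closed_closure.
by apply: open_closedC; exact: open_interior.
Qed.

Lemma surf_measurable_relatively_open (Omega Gamma : set pt) :
  relatively_open (boundary Omega) Gamma ->
  measurable (Gamma : set (caratheodory_type (hausdorff_om R d d.-1))).
Proof.
move=> [U oU ->]; apply: measurableI; first exact: surf_measurable_boundary.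
by apply: measurable_open => //; exact: hausdorff_halfspace.
Qed.

Lemma leb_bounded_lty (A : set pt) : bounded_set A -> (leb R d A < +oo)%E.
Proof.
move=> [M [_ AM]].
(* [bounded_set] provides every bound strictly above [M], whence [M + 1]. *)
have {AM} AM x : A x -> forall i, `|x 0 i| <= M + 1.
  move=> Ax i; apply: le_trans (AM (M + 1) _ x Ax); last by rewrite ltrDl.
  rewrite [leRHS]/Num.Def.normr /= mx_normrE.
  by apply/bigmax_geP; right => /=; exists (0, i).
set N := M + 1 in AM.
have [A0|/set0P[z Az]] := eqVneq A set0; first by rewrite A0 measure0.
(* Boxes exclude their lower faces, so the lower corner is moved down by [1]. *)
pose a : pt := \row__ (- `|N| - 1); pose b : pt := \row__ `|N|.
have Aab : A `<=` box a b.
  move=> x Ax i; rewrite !mxE; have := AM x Ax i; rewrite ler_norml => /andP[? ?].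
  by have := ler_norm N; have := ler_norm (- N); rewrite normrN => ? ?; lra.
have ab i : a 0 i <= b 0 i by rewrite !mxE; have := normr_ge0 N => ?; lra.
apply: (@le_lt_trans _ _ ((\prod_(i < d) (b 0 i - a 0 i))%:E)); last exact: ltry.
pose F k : set pt := if k is 0%N then box a b else set0.
apply: (@le_trans _ _ (\sum_(k <oo) gauge0 (@box_volume R d) (F k))%E).
  apply: ereal_inf_lbound; exists F => //; split => // x /Aab abx.
  by exists 0%N.
rewrite nneseries_recl//; last by move=> *; apply: gauge0_ge0 => U; exact: box_volume_ge0.
rewrite eseries0 ?adde0; last first.
  by move=> [|k] // _ _; rewrite gauge0_set0.
rewrite /gauge0 asboolF/=; last by move=> F0; have := Aab _ Az; rewrite F0.
by apply: ereal_inf_lbound; exists a, b.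
Qed.

End leb_surf.

(** * Linearity of H^1 *)

Section L2_theory.
Context (R : realType) (disp : measure_display) (T : measurableType disp).
Context (mu : {measure set T -> \bar R}) (D : set T).
Hypothesis mD : measurable D.
Implicit Types f g : T -> R.

(** The product is dominated by [f ^+ 2 + g ^+ 2]. *)
Lemma L2_mul f g : L2 mu D f -> L2 mu D g ->
  mu.-integrable D (EFin \o (fun x => f x * g x)).
Proof.
move=> [mf f2] [mg g2].
apply: le_integrable (integrableD mD f2 g2) => //.
  by apply/measurable_EFinP; exact: measurable_funM.
move=> x _; rewrite /= lee_fin normrM.
rewrite [leRHS]ger0_norm ?addr_ge0 ?sqr_ge0//.
rewrite -(real_normK (num_real (f x))) -(real_normK (num_real (g x))).
by have := sqr_ge0 (`|f x| - `|g x|); have := sqr_ge0 (`|f x| + `|g x|); nra.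
Qed.

Lemma measurable_fun_lin (a : R) f g : measurable_fun D f -> measurable_fun D g ->
  measurable_fun D (fun x => a * f x + g x).
Proof.
move=> mf mg; apply: measurable_funD => //.
by apply: measurable_funM => //; exact: measurable_cst.
Qed.

Lemma L2_lin (a : R) f g : L2 mu D f -> L2 mu D g -> L2 mu D (fun x => a * f x + g x).
Proof.
move=> Lf Lg; have fg := L2_mul Lf Lg; move: Lf Lg => [mf f2] [mg g2].
have mh := measurable_fun_lin a mf mg.
split => //.
have i1 := integrableZl mD (a ^+ 2) f2; have i2 := integrableZl mD (2 * a) fg.
apply: eq_integrable (integrableD mD (integrableD mD i1 i2) g2) => //.
by move=> x _ /=; rewrite -!EFinM -!EFinD; congr (_%:E); ring.
Qed.

Lemma Rintegral_lin (a : R) f g :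
  mu.-integrable D (EFin \o f) -> mu.-integrable D (EFin \o g) ->
  \int[mu]_(x in D) (a * f x + g x) =
    a * \int[mu]_(x in D) f x + \int[mu]_(x in D) g x.
Proof.
move=> if_ ig; rewrite -RintegralZl// -RintegralD//.
exact: (integrableZl mD a if_).
Qed.

(** The integrals are extended-valued, so that the bound applies to [h1norm2] and [bnorm2] before
    these are known to be finite. *)
Lemma ge0_integral_lin_le (a b : R) (F G H : T -> R) :
  0 <= a -> 0 <= b -> (forall x, 0 <= F x) -> (forall x, 0 <= G x) ->
  (forall x, 0 <= H x) ->
  measurable_fun D F -> measurable_fun D G -> measurable_fun D H ->
  (forall x, H x <= a * F x + b * G x) ->
  (\int[mu]_(x in D) (H x)%:E <=
     a%:E * \int[mu]_(x in D) (F x)%:E + b%:E * \int[mu]_(x in D) (G x)%:E)%E.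
Proof.
move=> a0 b0 F0 G0 H0 mF mG mH HFG.
rewrite -!ge0_integralZl_EFin//;
  try by [apply/measurable_EFinP|move=> x _; rewrite lee_fin].
rewrite -ge0_integralD//.
- apply: ge0_le_integral => //.
  + by move=> x _; rewrite lee_fin.
  + exact/measurable_EFinP.
  + apply/measurable_EFinP; apply: measurable_fun_lin => //.
    by apply: measurable_funM => //; exact: measurable_cst.
  + by move=> x _; rewrite -!EFinM -EFinD lee_fin.
- by move=> x _; rewrite -EFinM lee_fin mulr_ge0.
- by apply/measurable_EFinP; apply: measurable_funM => //; exact: measurable_cst.
- by move=> x _; rewrite -EFinM lee_fin mulr_ge0.
- by apply/measurable_EFinP; apply: measurable_funM => //; exact: measurable_cst.
Qed.

End L2_theory.

(** * Smooth functions form a vector space *)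

Section smooth.
Context (R : realType) (d : nat).
Local Notation pt := 'rV[R]_d.

Lemma partial_lin (i : 'I_d) (a : R) (f g : pt -> R) :
  (forall x, differentiable f x) -> (forall x, differentiable g x) ->
  partial i (fun x => a * f x + g x) = (fun x => a * partial i f x + partial i g x).
Proof.
move=> df dg; apply/funext => x; rewrite /partial.
rewrite (_ : (fun x => _) = (a \*: f) + g); last by apply/funext.
have Df : derivable f x (delta_mx 0 i) by exact: diff_derivable.
have Dg : derivable g x (delta_mx 0 i) by exact: diff_derivable.
by rewrite deriveD//; [rewrite deriveZ|exact: derivableZ].
Qed.

Lemma smooth_partials_lin (a : R) (f g : pt -> R) s : smooth f -> smooth g ->
  foldr (@partial R d) (fun x => a * f x + g x) s =
  (fun x => a * foldr (@partial R d) f s x + foldr (@partial R d) g s x).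
Proof.
by move=> sf sg; elim: s => [//|i s /= ->]; rewrite partial_lin.
Qed.

Lemma smooth_lin (a : R) (f g : pt -> R) : smooth f -> smooth g ->
  smooth (fun x => a * f x + g x).
Proof.
move=> sf sg s x; rewrite smooth_partials_lin//.
rewrite (_ : (fun x => _) =
  (a \*: foldr (@partial R d) f s) + foldr (@partial R d) g s);
  last by apply/funext.
by apply: differentiableD; [apply: differentiableZ; exact: sf|exact: sg].
Qed.

Lemma smooth_continuous (f : pt -> R) s : smooth f ->
  continuous (foldr (@partial R d) f s).
Proof. by move=> sf x; apply: differentiable_continuous; exact: sf. Qed.

End smooth.

Section h1rep_linear.
Context (R : realType).

(* Computing [fn (a *: v + w)] by plain conversion unfolds the whole lmodType
   structure of [h1rep]; these projections keep it syntactic. *)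
Let fst_lin (U V : lmodType R) (a : R) (x y : U * V) :
  (a *: x + y).1 = a *: x.1 + y.1.
Proof. by []. Qed.

Let snd_lin (U V : lmodType R) (a : R) (x y : U * V) :
  (a *: x + y).2 = a *: x.2 + y.2.
Proof. by []. Qed.

Let fct_lin (T : Type) (V : lmodType R) (a : R) (f g : T -> V) :
  a *: f + g = (fun x => a *: f x + g x).
Proof. by []. Qed.

Variable d : nat.
Local Notation pt := 'rV[R]_d.
Implicit Types v w : h1rep R d.

Lemma fn_lin (a : R) v w : fn (a *: v + w) = (fun x => a * fn v x + fn w x).
Proof.
transitivity (a *: (fn v : pt -> R^o) + fn w); last exact: fct_lin.
by rewrite /fn fst_lin; exact: fst_lin.
Qed.

Lemma gr_lin (a : R) v w x i :
  gr (a *: v + w) x 0 i = a * gr v x 0 i + gr w x 0 i.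
Proof.
have -> : gr (a *: v + w) = a *: (gr v : pt -> pt) + gr w.
  by rewrite /gr fst_lin; exact: snd_lin.
by rewrite fct_lin !mxE.
Qed.

Lemma tr_lin (a : R) v w : tr (a *: v + w) = (fun x => a * tr v x + tr w x).
Proof.
transitivity (a *: (tr v : pt -> R^o) + tr w); last exact: fct_lin.
exact: snd_lin.
Qed.

Lemma h1rep_ext v w : fn v = fn w -> (forall x i, gr v x 0 i = gr w x 0 i) ->
  tr v = tr w -> v = w.
Proof.
case: v w => [[fv gv] tv] [[fw gw] tw]; rewrite /fn /gr /tr/= => -> g ->.
by congr (_, _, _); apply/funext => x; apply/rowP => i.
Qed.

End h1rep_linear.

(** * Weak gradients, traces and the forms under linear combinations *)

Section H1_linear.
Context (R : realType) (d : nat) (Omega : set 'rV[R]_d).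
Local Notation lebT := (caratheodory_type (lebesgue_om R d)).
Local Notation surfT := (caratheodory_type (hausdorff_om R d d.-1)).
Local Notation pt := 'rV[R]_d.
Local Notation leb := (leb R d).
Local Notation surf := (surf R d).
Hypotheses (oOmega : open Omega) (bOmega : bounded_set Omega).
Implicit Types v w z : h1rep R d.

Let mOmega := leb_measurable_open oOmega.

(** [Omega] has finite measure and compact closure, on which [f ^+ 2] is bounded. This covers test
    functions and their partial derivatives. *)
Lemma continuous_L2 (f : pt -> R) : continuous f -> L2 leb Omega f.
Proof.
move=> cf; split; first exact: leb_measurable_continuous.
have cg : continuous (fun x => f x ^+ 2).
  move=> x; apply: (@continuous_comp _ _ _ f (fun y => y ^+ 2)); first exact: cf.
  exact: exprn_continuous.
apply: (@measurable_bounded_integrable _ _ _ leb (fun x => f x ^+ 2) Omega mOmega).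
- exact: leb_bounded_lty.
- exact: leb_measurable_continuous.
have Kc : compact (closure Omega).
  apply: bounded_closed_compact; last exact: closed_closure.
  move: bOmega => [M [Mr AM]]; exists M; split => // y My x clx.
  have cl : closed [set z : pt | `|z| <= y].
    rewrite (_ : [set z : pt | _] = Num.Def.normr @^-1` [set r | r <= y]); last by [].
    by apply: closed_comp => [z _|]; [exact: norm_continuous|exact: closed_le].
  by apply: cl; apply: closure_subset clx => z; exact: AM.
have : bounded_set ((fun x => f x ^+ 2) @` closure Omega).
  apply: compact_bounded; apply: continuous_compact Kc.
  exact: continuous_subspaceT.
move=> [M [Mr BM]]; exists M; split => // y My x Ox.
by apply: (BM y My); exists x => //; exact: subset_closure.
Qed.

Lemma weak_gradient_lin a v w :
  L2 leb Omega (fn v) -> (forall i, L2 leb Omega (fun x => gr v x 0 i)) ->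
  L2 leb Omega (fn w) -> (forall i, L2 leb Omega (fun x => gr w x 0 i)) ->
  weak_gradient Omega (fn v) (gr v) -> weak_gradient Omega (fn w) (gr w) ->
  weak_gradient Omega (fn (a *: v + w)) (gr (a *: v + w)).
Proof.
move=> Lv Lgv Lw Lgw gv gw phi i tphi.
have [sphi _] := tphi.
have Lphi : L2 leb Omega phi.
  by apply: continuous_L2; exact: (smooth_continuous (s := [::]) sphi).
have Ldphi : L2 leb Omega (partial i phi).
  by apply: continuous_L2; exact: (smooth_continuous (s := [:: i]) sphi).
transitivity (a * (\int[leb]_(x in Omega) (fn v x * partial i phi x)) +
    \int[leb]_(x in Omega) (fn w x * partial i phi x)).
  have iv := L2_mul mOmega Lv Ldphi; have iw := L2_mul mOmega Lw Ldphi.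
  rewrite -(Rintegral_lin mOmega a iv iw) fn_lin.
  by apply: eq_Rintegral => x _; rewrite mulrDl mulrA.
rewrite gv// gw//.
have iv := L2_mul mOmega (Lgv i) Lphi; have iw := L2_mul mOmega (Lgw i) Lphi.
rewrite mulrN -opprD; congr (- _).
rewrite -(Rintegral_lin mOmega a iv iw).
by apply: eq_Rintegral => x _; rewrite gr_lin mulrDl mulrA.
Qed.

Lemma dotv_ge0 (x : pt) : 0 <= dotv x x.
Proof. by apply: sumr_ge0 => i _; rewrite -expr2 sqr_ge0. Qed.

(** This is shared by the elements of [H1] and by each [smooth_rep phi] with [phi] smooth, hence by
    the differences occurring in [is_trace]. *)
Definition h1_measurable v := measurable_fun (Omega : set lebT) (fn v) /\
  forall i, measurable_fun (Omega : set lebT) (fun x => gr v x 0 i).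

Lemma h1_measurable_lin a v w : h1_measurable v -> h1_measurable w ->
  h1_measurable (a *: v + w).
Proof.
move=> [mv mgv] [mw mgw]; split.
  by rewrite fn_lin; exact: measurable_fun_lin.
move=> i; under eq_fun do rewrite gr_lin.
exact: measurable_fun_lin.
Qed.

Lemma h1_density_measurable v : h1_measurable v ->
  measurable_fun (Omega : set lebT)
    (fun x => fn v x ^+ 2 + dotv (gr v x) (gr v x)).
Proof.
move=> [mv mgv]; apply: measurable_funD; first exact: measurable_funX.
rewrite /dotv.
apply: measurable_sum => i; exact: measurable_funM.
Qed.

(** The pointwise bound [sq] on squares stands in for the triangle inequality; the constants do not
    matter for convergence to [0]. *)
Lemma h1norm2_lin_le a v w : h1_measurable v -> h1_measurable w ->
  (h1norm2 Omega (a *: v + w) <=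
    (2 * a ^+ 2)%:E * h1norm2 Omega v + 2%:E * h1norm2 Omega w)%E.
Proof.
move=> mv mw; have sq (s t : R) : (a * s + t) ^+ 2 <= 2 * a ^+ 2 * s ^+ 2 + 2 * t ^+ 2.
  by have := sqr_ge0 (a * s - t); nra.
have pos z x : 0 <= fn z x ^+ 2 + dotv (gr z x) (gr z x).
  by rewrite addr_ge0 ?sqr_ge0 ?dotv_ge0.
pose den z x := fn z x ^+ 2 + dotv (gr z x) (gr z x).
apply: (@ge0_integral_lin_le _ _ _ leb Omega mOmega _ _
    (den v) (den w) (den (a *: v + w))) => //;
  rewrite /den; try by move=> x; exact: pos.
- by rewrite mulr_ge0 ?sqr_ge0.
- exact: h1_density_measurable.
- exact: h1_density_measurable.
- by apply: h1_density_measurable; exact: h1_measurable_lin.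
move=> x; rewrite fn_lin !mulrDr addrACA; apply: lerD; first exact: sq.
rewrite /dotv !mulr_sumr -big_split/=; apply: ler_sum => i _.
by rewrite -!expr2 gr_lin; exact: sq.
Qed.

Lemma bnorm2_lin_le a v w :
  measurable_fun (boundary Omega : set surfT) (tr v) ->
  measurable_fun (boundary Omega : set surfT) (tr w) ->
  (bnorm2 Omega (a *: v + w) <=
    (2 * a ^+ 2)%:E * bnorm2 Omega v + 2%:E * bnorm2 Omega w)%E.
Proof.
move=> mv mw; have sq (s t : R) : (a * s + t) ^+ 2 <= 2 * a ^+ 2 * s ^+ 2 + 2 * t ^+ 2.
  by have := sqr_ge0 (a * s - t); nra.
have mb := @surf_measurable_boundary R d Omega.
rewrite /bnorm2 tr_lin.
apply: (@ge0_integral_lin_le _ _ _ surf (boundary Omega) mb _ _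
  (fun x => tr v x ^+ 2) (fun x => tr w x ^+ 2)
  (fun x => (a * tr v x + tr w x) ^+ 2)).
- by rewrite mulr_ge0 ?sqr_ge0.
- by [].
- by move=> x; rewrite sqr_ge0.
- by move=> x; rewrite sqr_ge0.
- by move=> x; rewrite sqr_ge0.
- exact: measurable_funX.
- exact: measurable_funX.
- by apply: measurable_funX; exact: measurable_fun_lin.
- by move=> x; exact: sq.
Qed.

Lemma cvge0_lin (F G H : nat -> \bar R) (a b : R) :
  (forall k, 0 <= H k)%E -> (forall k, H k <= a%:E * F k + b%:E * G k)%E ->
  F k @[k --> \oo] --> 0%E -> G k @[k --> \oo] --> 0%E ->
  H k @[k --> \oo] --> 0%E.
Proof.
move=> H0 HFG F0 G0.
apply: (@squeeze_cvge _ _ _ _ (cst 0%E) _ (fun k => a%:E * F k + b%:E * G k)%E).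
- by apply: nearW => k; rewrite H0 HFG.
- exact: cvg_cst.
- rewrite -[X in _ --> X](_ : a%:E * 0 + b%:E * 0 = 0)%E; last by rewrite !mule0 adde0.
  by apply: cvgeD; [rewrite !mule0|exact: cvgeZl|exact: cvgeZl].
Qed.

Lemma smooth_rep_measurable (phi : pt -> R) : smooth phi ->
  h1_measurable (smooth_rep phi).
Proof.
move=> sphi; split.
  by apply: leb_measurable_continuous; exact: (smooth_continuous (s := [::]) sphi).
move=> i; rewrite (_ : (fun x => _) = partial i phi); last first.
  by apply/funext => x; rewrite mxE.
by apply: leb_measurable_continuous; exact: (smooth_continuous (s := [:: i]) sphi).
Qed.

Lemma smooth_rep_lin a (phi psi : pt -> R) : smooth phi -> smooth psi ->
  smooth_rep (fun x => a * phi x + psi x) = a *: smooth_rep phi + smooth_rep psi.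
Proof.
move=> sphi spsi; apply: h1rep_ext => [|x i|]; rewrite ?fn_lin ?gr_lin ?tr_lin//.
by rewrite !mxE; exact: (congr1 (fun h => h x) (smooth_partials_lin a [:: i] sphi spsi)).
Qed.

Lemma H1_h1_measurable v : H1 Omega v -> h1_measurable v.
Proof. move=> [[mv _] Lg _ _]; split => [|i]; [exact: mv|exact: (proj1 (Lg i))]. Qed.

(** The same combination of the two approximating sequences approximates [a *: v + w], in the
    interior and on the boundary. *)
Lemma is_trace_lin a v w : h1_measurable v -> h1_measurable w ->
  is_trace Omega v -> is_trace Omega w -> is_trace Omega (a *: v + w).
Proof.
move=> mv mw [Lv [phi [sphi nphi bphi]]] [Lw [psi [spsi npsi bpsi]]].
split; first by rewrite tr_lin; apply: L2_lin => //; exact: surf_measurable_boundary.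
exists (fun k x => a * phi k x + psi k x).
have subE k : smooth_rep (fun x => a * phi k x + psi k x) - (a *: v + w) =
    a *: (smooth_rep (phi k) - v) + (smooth_rep (psi k) - w).
  by rewrite smooth_rep_lin// scalerBr opprD addrACA.
have msub z chi : smooth chi -> h1_measurable z -> h1_measurable (smooth_rep chi - z).
  move=> schi mz; rewrite addrC -scaleN1r.
  exact: (h1_measurable_lin (-1) mz (smooth_rep_measurable schi)).
split; first by move=> k; exact: smooth_lin.
- apply: (cvge0_lin _ _ nphi npsi).
    move=> k; apply: integral_ge0 => x _.
    by rewrite lee_fin addr_ge0 ?sqr_ge0 ?dotv_ge0.
  by move=> k; rewrite subE; apply: h1norm2_lin_le; exact: msub.
- apply: (cvge0_lin _ _ bphi bpsi).
    by move=> k; apply: integral_ge0 => x _; rewrite lee_fin sqr_ge0.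
  move=> k; rewrite subE; apply: bnorm2_lin_le.
    apply: measurable_funB; last by case: Lv.
    by apply: surf_measurable_continuous; exact: (smooth_continuous (s := [::])).
  apply: measurable_funB; last by case: Lw.
  by apply: surf_measurable_continuous; exact: (smooth_continuous (s := [::])).
Qed.

Lemma H1_lin a v w : H1 Omega v -> H1 Omega w -> H1 Omega (a *: v + w).
Proof.
move=> Hv Hw; have mv := H1_h1_measurable Hv; have mw := H1_h1_measurable Hw.
move: Hv Hw => [Lv Lgv gv tv] [Lw Lgw gw tw]; split.
- by rewrite fn_lin; exact: L2_lin.
- by move=> i; under eq_fun do rewrite gr_lin; exact: L2_lin.
- exact: weak_gradient_lin.
- exact: is_trace_lin.
Qed.

Lemma form_l_lin (f : pt -> R) a v w : L2 leb Omega f -> H1 Omega v -> H1 Omega w ->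
  form_l Omega f (a *: v + w) = a * form_l Omega f v + form_l Omega f w.
Proof.
move=> Lf [Lv _ _ _] [Lw _ _ _].
have iv := L2_mul mOmega Lf Lv; have iw := L2_mul mOmega Lf Lw.
rewrite /form_l fn_lin -(Rintegral_lin mOmega a iv iw).
by apply: eq_Rintegral => x _; rewrite mulrDr mulrCA.
Qed.

Lemma form_a_sym v w : form_a Omega v w = form_a Omega w v.
Proof.
by apply: eq_Rintegral => x _; apply: eq_bigr => i _; rewrite mulrC.
Qed.

Lemma form_a_lin a v w z : H1 Omega v -> H1 Omega w -> H1 Omega z ->
  form_a Omega (a *: v + w) z = a * form_a Omega v z + form_a Omega w z.
Proof.
have int v1 v2 : H1 Omega v1 -> H1 Omega v2 ->
    leb.-integrable Omega (EFin \o (fun x => dotv (gr v1 x) (gr v2 x))).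
  move=> [_ L1 _ _] [_ L2 _ _].
  have := @integrable_sum _ _ _ leb Omega mOmega 'I_d (index_enum 'I_d) xpredT
    (fun i x => (gr v1 x 0 i * gr v2 x 0 i)%:E).
  move=> /(_ (fun i _ => L2_mul mOmega (L1 i) (L2 i))).
  by apply: eq_integrable => // x _; rewrite sumEFin.
move=> Hv Hw Hz; have iv := int _ _ Hv Hz; have iw := int _ _ Hw Hz.
rewrite /form_a -(Rintegral_lin mOmega a iv iw).
apply: eq_Rintegral => x _; rewrite /dotv mulr_sumr -big_split/=.
by apply: eq_bigr => i _; rewrite gr_lin mulrDl mulrA.
Qed.

End H1_linear.

(** * The logarithmic barrier *)

Section log_barrier.
Context (R : realType) (disp : measure_display) (T : measurableType disp).
Context (mu : {measure set T -> \bar R}) (D : set T).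
Hypotheses (mD : measurable D) (Dfin : (mu D < +oo)%E).
Implicit Types p q r : T -> R.

Lemma measurable_Phi : measurable_fun [set: R] (@Phi R).
Proof.
apply: measurable_fun_ifT.
- exact: measurable_fun_ltr.
- apply/measurable_EFinP; apply: measurable_funN; exact: measurable_ln.
- exact: measurable_cst.
Qed.

Lemma ln_le_sub1 (x : R) : 0 < x -> ln x <= x - 1.
Proof.
move=> x0; have := @le_ln1Dx R (x - 1); rewrite addrCA subrr addr0; apply; lra.
Qed.

(** From [ln t <= t - 1]. The quadratic bound makes the negative part of the barrier integrand
    integrable when the gap is in [L2] and the measure is finite. *)
Lemma Phi_ge (t : R) : ((- (1 + t ^+ 2))%:E <= Phi t)%E.
Proof.
rewrite /Phi; case: ifPn => [t0|_]; last by rewrite leey.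
rewrite lee_fin lerN2; apply: (le_trans (ln_le_sub1 t0)).
by have := sqr_ge0 (t - 1); nra.
Qed.

Lemma mine_Phi_bound (a y c : R) :
  (`|mine (Phi a) (Phi y + c%:E)| <= `| `|Phi y + c%:E| + (1 + a ^+ 2)%:E |)%E.
Proof.
have s0 : 0 <= 1 + a ^+ 2 by rewrite addr_ge0 ?sqr_ge0.
have := Phi_ge a; set s := 1 + a ^+ 2 in s0 *; move: s s0 => s s0.
rewrite [Phi y]/Phi; case: ifPn => _; last by move=> _; rewrite addye//= leey.
rewrite -EFinD; set z := - ln y + c.
have z1 := ler_norm z; have z2 := ler_norm (- z); rewrite normrN in z2.
have -> : (`| `|z%:E| + s%:E| = (`|z| + s)%:E)%E.
  by rewrite /= ger0_norm// addr_ge0.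
case: (Phi a) => [b|_|//]; last by rewrite minye/= lee_fin lerDl.
rewrite lee_fin => sb; rewrite -EFin_min/= lee_fin ler_norml le_min ge_min.
by apply/andP; split; [apply/andP; split|apply/orP; right]; lra.
Qed.

Lemma integrable_const (c : R) : mu.-integrable D (cst c%:E).
Proof.
apply/integrableP; split; first exact: measurable_cst.
by rewrite integral_cst// lte_mul_pinfty.
Qed.

Lemma measurable_Phi_comp r : measurable_fun D r -> measurable_fun D (@Phi R \o r).
Proof. by move=> mr; apply: measurableT_comp => //; exact: measurable_Phi. Qed.

Lemma integrable_1Dsqr r : L2 mu D r ->
  mu.-integrable D (fun x => (1 + r x ^+ 2)%:E).
Proof. by move=> [_ r2]; exact: (integrableD mD (integrable_const 1) r2). Qed.

(** The negative part has finite integral by [Phi_ge], so an integral below [+oo] forces the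
    positive part to be finite as well. *)
Lemma Phi_integrable p : L2 mu D p -> (\int[mu]_(x in D) Phi (p x) < +oo)%E ->
  mu.-integrable D (@Phi R \o p).
Proof.
move=> Lp; have mPhi := measurable_Phi_comp (proj1 Lp).
have neg : (\int[mu]_(x in D) (@Phi R \o p)^\- x < +oo)%E.
  apply: le_lt_trans (integrable_lty mD (integrable_1Dsqr Lp)).
  apply: ge0_le_integral => //; first exact: measurable_funeneg.
    by apply: (measurable_int mu); exact: integrable_1Dsqr.
  move=> x _; rewrite funenegE ge_max /= leeNl Phi_ge/= lee_fin.
  by rewrite addr_ge0 ?sqr_ge0.
rewrite integralE => pos; apply/integrableP; split => //.
rewrite (eq_integral (fun x => ((@Phi R \o p)^\+ x + (@Phi R \o p)^\- x)%E)); last first.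
  by move=> x _; rewrite -[LHS]/((abse \o (@Phi R \o p)) x) fune_abse.
rewrite ge0_integralD//; [|exact: measurable_funepos|exact: measurable_funeneg].
apply: lte_add_pinfty => //; move: pos neg.
set P := (\int[mu]_(x in D) (_^\+ x))%E; set N := (\int[mu]_(x in D) (_^\- x))%E.
have N0 : (0 <= N)%E by apply: integral_ge0.
move=> + Noo; rewrite lteBlDr ?ge0_fin_numE// addye//.
by rewrite gt_eqF// (lt_le_trans _ N0)// ltNy0.
Qed.

(** Almost everywhere [r >= (1 - t) * p], and [Phi] is decreasing, so [Phi r] exceeds [Phi p] by at
    most [- ln (1 - t) = ln ((1 - t)^-1) <= (1 - t)^-1 - 1 = t / (1 - t)]. *)
Lemma integral_Phi_convex p q r (t : R) : 0 < t -> t < 1 ->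
  L2 mu D p -> L2 mu D r -> (\int[mu]_(x in D) Phi (p x) < +oo)%E ->
  {ae mu, forall x, D x -> 0 <= q x} ->
  (forall x, D x -> r x = (1 - t) * p x + t * q x) ->
  (\int[mu]_(x in D) Phi (r x) <=
    \int[mu]_(x in D) Phi (p x) + (t / (1 - t))%:E * mu D)%E.
Proof.
move=> t0 t1 Lp Lr pfin q0 rE; set c := t / (1 - t).
have intp := Phi_integrable Lp pfin.
have intc := integrable_const c.
have intpc := integrableD mD intp intc.
(* The truncation agrees with [Phi (r x)] almost everywhere, is integrable by [mine_Phi_bound], and
   satisfies the upper bound at every point. *)
pose F x : \bar R := mine (Phi (r x)) (Phi (p x) + c%:E).
have mF : measurable_fun D F.
  apply: measurable_mine; first exact: measurable_Phi_comp (proj1 Lr).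
  exact: (measurable_int mu intpc).
have intF : mu.-integrable D F.
  apply: le_integrable mF _
    (integrableD mD (integrable_abse intpc) (integrable_1Dsqr Lr)) => //.
  by move=> x _; exact: mine_Phi_bound.
have -> : (\int[mu]_(x in D) Phi (r x) = \int[mu]_(x in D) F x)%E.
  apply: ae_eq_integral => //; first exact: measurable_Phi_comp (proj1 Lr).
  apply: filterS q0 => x qx Dx; rewrite /F; apply/esym/min_idPl.
  have q0 := qx Dx; rewrite {2}/Phi; case: ifPn => p0; last by rewrite addye// leey.
  have p1 : 0 < (1 - t) * p x by rewrite mulr_gt0// subr_gt0.
  have pr : (1 - t) * p x <= r x by rewrite rE// lerDl mulr_ge0// ltW.
  rewrite /Phi (lt_le_trans p1 pr) -EFinD lee_fin.
  apply: (@le_trans _ _ (- ln ((1 - t) * p x))).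
    by rewrite lerN2 ler_ln ?posrE// (lt_le_trans p1 pr).
  rewrite lnM ?posrE ?subr_gt0// opprD addrC lerD2l.
  rewrite -lnV ?posrE ?subr_gt0//; apply: le_trans (ln_le_sub1 _) _.
    by rewrite invr_gt0 subr_gt0.
  rewrite /c le_eqVlt; apply/orP; left; apply/eqP; field; lra.
have -> : (\int[mu]_(x in D) Phi (p x) + c%:E * mu D =
    \int[mu]_(x in D) (Phi (p x) + c%:E))%E.
  by rewrite integralD// integral_cst.
apply: le_integral => // x _; rewrite /F ge_min.
by apply/orP; right.
Qed.

(** An integrable function is finite almost everywhere, and [Phi] is finite only at positive
    arguments. *)
Lemma Phi_ae_gt0 p : L2 mu D p -> (\int[mu]_(x in D) Phi (p x) < +oo)%E ->
  {ae mu, forall x, D x -> 0 < p x}.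
Proof.
move=> Lp pfin; have := integrable_ae mD (Phi_integrable Lp pfin).
apply: filterS => x h Dx; move: (h Dx); rewrite /= /Phi.
by case: ifP.
Qed.

End log_barrier.

(** * The energy and the admissible set along segments *)

Section signorini_theory.
Context (R : realType) (d : nat) (Omega GammaD GammaC : set 'rV[R]_d).
Context (f g : 'rV[R]_d -> R).
Local Notation surf := (surf R d).
Implicit Types v w z e : h1rep R d.
Hypotheses (oOmega : open Omega) (bOmega : bounded_set Omega).

Lemma space_V_lin (a : R) v w : space_V Omega GammaD v -> space_V Omega GammaD w ->
  space_V Omega GammaD (a *: v + w).
Proof.
move=> [Hv v0] [Hw w0]; split; first exact: H1_lin.
apply: (filterS2 (ae_filter_ringOfSetsType surf) _ v0 w0) => x vx wx Dx.
by rewrite tr_lin vx// wx// mulr0 addr0.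
Qed.

Lemma energy_lin (t : R) e z : L2 (leb R d) Omega f -> H1 Omega e -> H1 Omega z ->
  energy Omega f (t *: e + z) =
  energy Omega f z + t * (form_a Omega e z - form_l Omega f e) +
    t ^+ 2 / 2 * form_a Omega e e.
Proof.
move=> Lf He Hz; have Htz : H1 Omega (t *: e + z) by exact: H1_lin.
rewrite /energy (form_l_lin oOmega)// (form_a_lin oOmega)//.
rewrite [form_a Omega e (t *: e + z)]form_a_sym (form_a_lin oOmega)//.
rewrite [form_a Omega z (t *: e + z)]form_a_sym (form_a_lin oOmega)//.
by rewrite [form_a Omega z e]form_a_sym; field.
Qed.

Lemma set_K_segment (t : R) u v : 0 <= t -> t <= 1 ->
  set_K Omega GammaD GammaC g u -> set_K Omega GammaD GammaC g v ->
  set_K Omega GammaD GammaC g (t *: (v - u) + u).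
Proof.
move=> t0 t1 [Vu ug] [Vv vg]; rewrite -scaleN1r [v + _]addrC.
have Ve : space_V Omega GammaD (-1 *: u + v) by exact: space_V_lin.
split; first exact: space_V_lin.
apply: (filterS2 (ae_filter_ringOfSetsType surf) _ ug vg) => x ux vx Cx.
by rewrite !tr_lin; have := ux Cx; have := vx Cx; nra.
Qed.

End signorini_theory.

(** * The error estimate *)

Lemma le_of_shrinking_factor (R : realFieldType) (A m : R) : 0 <= m ->
  (forall t, 0 < t -> t < 1 -> A * (1 - t) ^+ 2 <= m) -> A <= m.
Proof.
move=> m0 h; rewrite leNgt; apply/negP => mA.
have A0 : 0 < A by exact: le_lt_trans mA.
(* An explicit [t] replaces the limit: here [A * (1 - t) ^+ 2 >= A - 2 * t * A = (A + m) / 2 >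
   m]. *)
set t := (A - m) / (4 * A).
have tE : t * (4 * A) = A - m by rewrite /t; field; rewrite gt_eqF.
have t0 : 0 < t by rewrite divr_gt0 ?subr_gt0// mulr_gt0.
have t1 : t < 1 by rewrite ltr_pdivrMr ?mulr_gt0//; lra.
by have := h t t0 t1; nra.
Qed.

Theorem lemma5p1 (R : realType) (d : nat) (hd : d = 2%N \/ d = 3%N)
    (Omega GammaD GammaC : set 'rV[R]_d) (f g : 'rV[R]_d -> R) (cP : R)
    (hOmega : polyhedral_lipschitz_domain Omega)
    (hGamma : boundary_decomposition Omega GammaD GammaC)
    (hGammaD : (0 < surf R d GammaD)%E)
    (hf : L2 (leb R d) Omega f)
    (hg : H12 GammaC g)
    (hcP : poincare_constant Omega GammaD cP)
    (hK : set_K Omega GammaD GammaC g !=set0)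
    (hB : dom_B Omega GammaD GammaC g !=set0)
    (mu : R) (hmu : 0 < mu)
    (u : h1rep R d) (hu : signorini_solution Omega GammaD GammaC f g u)
    (u_mu : h1rep R d)
    (hu_mu : barrier_minimizer Omega GammaD GammaC f g mu u_mu) :
  ((h1norm Omega (u - u_mu) ^+ 2)%:E
     <= (cP^-1)%:E * surf R d GammaC * mu%:E)%E.
Proof.
have [[oOmega _ _ bOmega] _] := hOmega.
have [cP0 poincare] := hcP.
have [_ roC _ clU] := hGamma.
have mC := surf_measurable_relatively_open roC.
have [Coo|] := eqVneq (surf R d GammaC) +oo%E.
  by rewrite Coo gt0_muley ?lte_fin ?invr_gt0// gt0_mulye ?lte_fin// leey.
rewrite -ltey => Cfin; have Cfin' : surf R d GammaC \is a fin_num.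
  by rewrite ge0_fin_numE.
set M := fine (surf R d GammaC).
have ME : surf R d GammaC = M%:E by rewrite /M fineK.
have M0 : 0 <= M by apply: fine_ge0.
have [Ku umin] := hu; have [Vmu mumin] := hu_mu.
have [Vu ug] := Ku.
have LC v : space_V Omega GammaD v -> L2 (surf R d) GammaC (fun x => g x - tr v x).
  move=> [[_ _ _ [[mv iv] _]] _].
  have Lv : L2 (surf R d) GammaC (tr v).
    have Cb : GammaC `<=` boundary Omega.
      by rewrite -clU => x Cx; right; exact: subset_closure.
    have mb := @surf_measurable_boundary R d Omega.
    by split; [exact: measurable_funS mv|exact: integrableS iv].
  have := L2_lin mC (-1) Lv (proj1 hg).
  by under eq_fun do rewrite mulN1r addrC.
(* An infinite barrier would make [energy_mu] infinite at [u_mu], against its finite value at a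
   point of [dom_B]. *)
have bfin : (barrier GammaC g u_mu < +oo)%E.
  have [v0 [Vv0 bv0]] := hB; have := mumin v0 Vv0.
  rewrite /energy_mu ltNge leye_eq => h; apply/negP => /eqP boo; move: h.
  rewrite boo gt0_muley ?lte_fin// addey// leye_eq => /eqP h.
  have : ((energy Omega f v0)%:E + mu%:E * barrier GammaC g v0 < +oo)%E.
    by rewrite lte_add_pinfty ?ltry// lte_mul_pinfty// ?lee_fin ?ltW.
  by rewrite h.
have intmu := Phi_integrable mC Cfin (LC _ Vmu) bfin.
have bnum : barrier GammaC g u_mu \is a fin_num by exact: integrable_fin_num intmu.
(* A finite barrier keeps the gap positive almost everywhere, so the segment from [u] to [u_mu]
   stays in [set_K]. *)
have Kmu : set_K Omega GammaD GammaC g u_mu.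
  split => //; have := Phi_ae_gt0 mC Cfin (LC _ Vmu) bfin.
  by apply: filterS => x h Cx; rewrite -subr_ge0 ltW// h.
pose e := u - u_mu.
have Ve : space_V Omega GammaD e.
  by rewrite /e -scaleN1r addrC; exact: space_V_lin.
have uE : u = 1 *: e + u_mu by rewrite scale1r subrK.
have He := proj1 Ve; have Hu := proj1 Vu; have Hmu := proj1 Vmu.
have trE x : tr u x = 1 * tr e x + tr u_mu x by rewrite {1}uE tr_lin.
pose A := form_a Omega e e.
have AE : form_a Omega e u = A + form_a Omega e u_mu.
  rewrite [LHS]form_a_sym {1}uE (form_a_lin oOmega)// mul1r.
  by rewrite [form_a _ u_mu e]form_a_sym.
have key t : 0 < t -> t < 1 -> A * (1 - t) ^+ 2 <= mu * M.
  move=> t0 t1.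
  have Eu : energy Omega f u <= energy Omega f ((- t) *: e + u).
    rewrite -[(- t) *: e](_ : t *: (u_mu - u) = _); last first.
      by rewrite -(opprB u) scalerN scaleNr.
    by apply: umin; apply: set_K_segment => //; exact: ltW.
  have Vt : space_V Omega GammaD (t *: e + u_mu) by exact: space_V_lin.
  have bt : (barrier GammaC g (t *: e + u_mu) <=
      barrier GammaC g u_mu + (t / (1 - t) * M)%:E)%E.
    rewrite EFinM -ME.
    have q0 : {ae surf R d, forall x, GammaC x -> 0 <= g x - tr u x}.
      apply: (@filterS _ _ (ae_filter_ringOfSetsType (surf R d)) _ _ _ ug) => x h Cx.
      by rewrite subr_ge0 h.
    (* The gap of [t *: e + u_mu] is [1 - t] times the gap of [u_mu] plus [t] times that of [u]. *)
    apply: (integral_Phi_convex mC Cfin t0 t1 (LC _ Vmu) (LC _ Vt) bfin q0).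
    by move=> x _; rewrite tr_lin trE; ring.
  have := mumin _ Vt; rewrite /energy_mu => h.
  have {h} Emu : energy Omega f u_mu <=
      energy Omega f (t *: e + u_mu) + mu * (t / (1 - t) * M).
    have mu0 : (0 <= mu%:E)%E by rewrite lee_fin ltW.
    have := le_trans h (leeD2l _ (lee_wpmul2l mu0 bt)).
    move: bnum; case: (barrier GammaC g u_mu) => [b| |]// _.
    by rewrite -EFinD -!EFinM -!EFinD !lee_fin; lra.
  move: Eu Emu; rewrite !energy_lin// AE -/A.
  set q := form_a _ _ _ - _.
  have t1' : 1 - t != 0 by rewrite subr_eq0 gt_eqF.
  have cE : t / (1 - t) * (1 - t) = t by rewrite divfK.
  move: cE; set c := t / _ => cE.
  set a1 := form_a Omega e u_mu in q *; set l := form_l _ _ _ in q *.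
  rewrite /q => E1 E2.
  (* In the sum of [E1] and [E2] the terms in [l] and [a1] cancel, leaving
     [0 <= - t * A + t ^+ 2 * A + mu * (c * M)]. *)
  have tA : t * (A * (1 - t)) <= mu * (c * M).
    by move: E1 E2; set x := energy _ _ u; set y := energy _ _ u_mu; nra.
  (* Multiplying [tA] by [1 - t] turns [c] into [t], which then cancels on both sides. *)
  rewrite -(ler_pM2l t0).
  have -> : t * (mu * M) = mu * (c * M) * (1 - t) by rewrite -[in LHS]cE; ring.
  have -> : t * (A * (1 - t) ^+ 2) = t * (A * (1 - t)) * (1 - t) by ring.
  by rewrite ler_pM2r ?subr_gt0.
have AM : A <= mu * M.
  by apply: le_of_shrinking_factor key; rewrite mulr_ge0// ltW.
rewrite ME -!EFinM lee_fin -mulrA mulrC ler_pdivlMr// mulrC.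
by apply: le_trans (poincare _ Ve) _; rewrite mulrC.
Qed.
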